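(* Let $x,y$ be two distinct variables. The stalactic monoid $\mathsf{stal}$ satisfies the non-trivial identity $xyx=yxx$. Furthermore, up to equivalence, this is the unique shortest non-trivial identity satisfied by $\mathsf{stal}$.
   Context: Identities: An identity over an alphabet $X$ of variables is a formal equality $u=v$ with $u,v$ in the free monoid $X^*$; it is non-trivial if $u\neq v$ as words. A monoid $M$ satisfies $u=v$ if $\phi(u)=\phi(v)$ for every monoid homomorphism $\phi:X^*\to M$. A shortest non-trivial identity satisfied by $M$ is a non-trivial identity $u=v$ satisfied by $M$ with $|u|+|v|$ minimal among all non-trivial identities (over any alphabet) satisfied by $M$. Two identities are equivalent if one can be obtained from the other by possibly renaming variables (bijectively) and possibly swapping the two sides. Stalactic monoid: Let $\mathcal{A}=\{1<2<3<\cdots\}$ be the natural numbers viewed as an infinite ordered alphabet. A stalactic tableau is a finite array of symbols of $\mathcal{A}$ in which columns are top-aligned, and two symbols appear in the same column if and only if they are equal. Insertion of a symbol $a\in\mathcal{A}$ into a stalactic tableau $T$: if $a$ does not appear in $T$, add $a$ to the left of the top row of $T$ (as a new column); if $a$ appears in $T$, add $a$ to the bottom of the unique column in which $a$ appears. For $w\in\mathcal{A}^*$, $\mathrm{P}_{\mathsf{stal}}(w)$ is the stalactic tableau obtained by starting with the empty tableau and inserting the symbols of $w$ one by one, proceeding through $w$ from right to left. The relation $u\equiv_{\mathsf{stal}}v\iff \mathrm{P}_{\mathsf{stal}}(u)=\mathrm{P}_{\mathsf{stal}}(v)$ is a congruence on $\mathcal{A}^*$, and the stalactic monoid is $\mathsf{stal}=\mathcal{A}^*/{\equiv_{\mathsf{stal}}}$.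 *)

(* Defs.v *)
From HB Require Import structures.
From Stdlib Require List.
From mathcomp Require Import all_boot.

Set Implicit Arguments.
Unset Strict Implicit.
Unset Printing Implicit Defensive.

Local Open Scope group_scope.
Local Open Scope quotient_scope.

(* [word X] is the free monoid over X. MathComp's monoidType requires a
   choiceType carrier, but 1 and the product exist over any type, and this is
   all that [monoid_morphism] needs; alphabets of variables are thus arbitrary
   types. *)
Definition word (X : Type) : Type := seq X.

HB.instance Definition _ (X : Type) := hasMul.Build (word X) (@cat X).
HB.instance Definition _ (X : Type) := hasOne.Build (word X) [::].

HB.instance Definition _ (X : choiceType) := Choice.on (word X).
HB.instance Definition _ (X : choiceType) :=
  Magma_isSemigroup.Build (word X) (@catA X).
HB.instance Definition _ (X : choiceType) :=
  BaseUMagma_isUMagma.Build (word X) (@cat0s X) (@cats0 X).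

Definition satisfies (M : monoidType) (X : Type) (u v : word X) : Prop :=
  forall phi : word X -> M, monoid_morphism phi -> phi u = phi v.

Definition shortest_identity (M : monoidType) (X : Type) (u v : word X) : Prop :=
  [/\ u <> v, satisfies M u v
    & forall (Y : Type) (u' v' : word Y), u' <> v' -> satisfies M u' v' ->
        size u + size v <= size u' + size v'].

(* Only the variables that occur in the identity have to be renamed
   injectively: the alphabets X and Y may have unused variables. *)
Definition renaming (X Y : Type) (u v : word X) (u' v' : word Y) : Prop :=
  exists f : X -> Y,
    [/\ forall a b, List.In a (u ++ v) -> List.In b (u ++ v) ->
          f a = f b -> a = b,
        map f u = u' & map f v = v'].

Definition equivalent_identities (X Y : Type)
    (u v : word X) (u' v' : word Y) : Prop :=
  renaming u v u' v' \/ renaming u v v' u'.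

Definition letter : Type := {n : nat | 0 < n}.

(* Columns are listed from left to right, and each column from top to bottom. *)
Definition tableau : Type := seq (seq letter).

Definition stalactic (T : tableau) : Prop :=
  (forall c, c \in T -> c <> [::]) /\
  (forall i j a b, i < size T -> j < size T ->
     a \in nth [::] T i -> b \in nth [::] T j -> i = j <-> a = b).

Definition insert (a : letter) (T : tableau) : tableau :=
  if a \in flatten T then [seq if a \in c then rcons c a else c | c <- T]
  else [:: a] :: T.

(* [foldr] reads the word from right to left. *)
Definition P_stal (w : word letter) : tableau := foldr insert [::] w.

Lemma P_stalE w : P_stal w = [seq nseq (count_mem a w) a | a <- undup w].
Proof.
elim: w => [//|a w IHw]; rewrite /P_stal /= -/(P_stal w) IHw /insert.
have -> : (a \in flatten [seq nseq (count_mem b w) b | b <- undup w])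
    = (a \in w).
  apply/flatten_mapP/idP => [[b] | aw].
    by rewrite mem_undup mem_nseq => bw /andP[_ /eqP->].
  by exists a; rewrite ?mem_undup // mem_nseq -has_count has_pred1 aw /=.
case: ifPn => aw.
  rewrite -map_comp; apply/eq_in_map => b; rewrite mem_undup => bw /=.
  rewrite mem_nseq -has_count has_pred1 bw /=.
  case: eqVneq => [<-|//]; rewrite add1n.
  by elim: (count_mem a w) => //= n ->.
rewrite /= eqxx add1n (count_memPn aw); congr (_ :: _).
apply/eq_in_map => b; rewrite mem_undup => bw.
by case: eqVneq bw aw => [-> -> //|].
Qed.

Lemma P_stal_stalactic w : stalactic (P_stal w).
Proof.
rewrite P_stalE; split=> [c /mapP[a]|i j a b].
  by rewrite mem_undup -has_pred1 has_count => + ->; case: count.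
rewrite size_map => lti ltj.
have [x0 _] : exists x0, x0 \in undup w by exists (nth a (undup w) i); rewrite mem_nth.
rewrite !(nth_map x0) // !mem_nseq => /andP[_ /eqP->] /andP[_ /eqP->].
split=> [->//|/eqP]; by rewrite nth_uniq ?undup_uniq // => /eqP.
Qed.

Lemma P_stalP u v :
  P_stal u = P_stal v <->
  undup u = undup v /\ (forall a, count_mem a u = count_mem a v).
Proof.
rewrite !P_stalE; split=> [eq_uv|[-> eqc]]; last first.
  by apply: eq_map => a; rewrite eqc.
have headE w : pmap ohead [seq nseq (count_mem a w) a | a <- undup w] = undup w.
  have: {subset undup w <= w} by move=> a; rewrite mem_undup.
  elim: (undup w) => //= a s IHs sw.
  have : a \in w by apply: sw; rewrite mem_head.
  rewrite -has_pred1 has_count; case: count => //= n _.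
  by rewrite IHs // => b bs; apply: sw; rewrite inE bs orbT.
have eq_undup : undup u = undup v by rewrite -headE eq_uv headE.
split=> // a; have [au|aNu] := boolP (a \in u); last first.
  have aNv : a \notin v by rewrite -mem_undup -eq_undup mem_undup.
  by rewrite (count_memPn aNu) (count_memPn aNv).
move: eq_uv; rewrite -eq_undup => /eq_in_map /(_ a); rewrite mem_undup => /(_ au).
by move=> /(congr1 size); rewrite !size_nseq.
Qed.

Definition stal_rel : rel (word letter) := fun u v => P_stal u == P_stal v.

Lemma stal_rel_equiv : equiv_class_of stal_rel.
Proof.
rewrite /stal_rel; split=> [u|u v|v u w].
- exact: eqxx.
- exact: eq_sym.
- by move=> /eqP-> /eqP->; exact: eqxx.
Qed.

Canonical stal_equiv := EquivRelPack stal_rel_equiv.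

Lemma stal_rel_cat u u' v v' :
  stal_rel u u' -> stal_rel v v' -> stal_rel (u ++ v) (u' ++ v').
Proof.
move=> /eqP/P_stalP[uu cu] /eqP/P_stalP[vv cv]; apply/eqP/P_stalP; split.
  rewrite !undup_cat uu vv; congr (_ ++ _); apply: eq_filter => a.
  by rewrite -mem_undup vv mem_undup.
by move=> a; rewrite !count_cat cu cv.
Qed.

Definition stal : Type := {eq_quot stal_equiv}.
HB.instance Definition _ := Choice.on stal.
HB.instance Definition _ := EqQuotient.on stal.

Definition stal_one : stal := \pi_stal (1 : word letter).
Definition stal_mul : stal -> stal -> stal := lift_op2 stal *%g.

Lemma pi_stal_mul :
  {morph \pi_stal : u v / (u : word letter) * v >-> stal_mul u v}.
Proof.
move=> u v; unlock stal_mul; apply/eqmodP.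
by apply: stal_rel_cat; rewrite -[stal_rel _ _]/(stal_equiv _ _);
   apply/eqmodP; rewrite reprK.
Qed.

Lemma stal_mulA : associative stal_mul.
Proof.
move=> a b c; rewrite -[a]reprK -[b]reprK -[c]reprK.
by rewrite -!pi_stal_mul mulgA.
Qed.

Lemma stal_mul1 : left_id stal_one stal_mul.
Proof. by move=> a; rewrite -[a]reprK -pi_stal_mul mul1g. Qed.

Lemma stal_mulr1 : right_id stal_one stal_mul.
Proof. by move=> a; rewrite -[a]reprK -pi_stal_mul mulg1. Qed.

HB.instance Definition _ := isMonoid.Build stal stal_mulA stal_mul1 stal_mulr1.

(* Main.v *)
Require Import Defs.
From mathcomp Require Import all_boot boolp.

(** Substituting words for the variables of [w], the order of last occurrences
    in the result depends only on the order of last occurrences in [w], and its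
    contents only on the contents of [w].  As [P_stal] records exactly these two
    data (the function [undup] keeps last occurrences), [stal] satisfies [u = v]
    if [undup u = undup v] and [u] is a permutation of [v].  These conditions are
    also necessary, because the variables can be mapped to distinct generators
    ([satisfies_stalP]).

    The sides of a satisfied identity thus have equal length and, unless they are
    empty, end with the same letter, the last one of [undup].  If they are
    different words of length at most 3, removing this common letter leaves two
    different words of length at most 2 with the same contents, which must be
    [pq] and [qp] with [p <> q].
    The common last letter [c] is [p] or [q], since otherwise the orders of last
    occurrences in [pqc] and [qpc] would differ; and [c = p] or [c = q] gives
    the identity [xyx = yxx] up to renaming and exchange of sides
    ([short_undup_perm]).  A nontrivial satisfied identity of total length at
    most 6 is therefore equivalent to that one, which has total length exactly
    6: this gives both minimality and uniqueness.

    Alphabets of variables are arbitrary types; they are given a decidable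
    equality classically, through [{classic X}], to speak of [undup] and
    [perm_eq]. *)

(** * Words and their last occurrences *)

Lemma undup_map_inj_in {T U : eqType} (f : T -> U) (s : seq T) :
  {in s &, injective f} -> undup (map f s) = map f (undup s).
Proof.
elim: s => //= a s IHs f_inj.
have s_inj : {in s &, injective f}.
  by move=> b c bs cs; apply: f_inj; rewrite inE ?bs ?cs orbT.
have -> : (f a \in map f s) = (a \in s).
  apply/mapP/idP => [[b bs /f_inj eq_ab] | ?]; last by exists a.
  by rewrite eq_ab // ?mem_head // inE bs orbT.
by case: ifP => _ /=; rewrite IHs.
Qed.

Lemma perm_map_inj_in {T U : eqType} (f : T -> U) (s t : seq T) :
  {in s ++ t &, injective f} -> perm_eq (map f s) (map f t) -> perm_eq s t.
Proof.
move=> f_inj /permP eq_st; apply/allP => a a_st; apply/eqP.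
have countE w : {subset w <= s ++ t} ->
    count_mem (f a) (map f w) = count_mem a w.
  move=> sub; rewrite count_map; apply/eq_in_count => b /sub b_st /=.
  exact: inj_in_eq f_inj _ _ b_st a_st.
rewrite -!countE ?eq_st // => b; rewrite mem_cat => ->; rewrite ?orbT //.
Qed.

Lemma mem_In {T : eqType} (a : T) (s : seq T) : List.In a s -> a \in s.
Proof.
by elim: s => //= b s IHs; rewrite inE => -[-> | /IHs ->];
   rewrite ?eqxx ?orbT.
Qed.

(** Only the last occurrence of a letter [a] can contribute last occurrences
    to the image: the block [r a] placed at an earlier occurrence is hidden by
    the one placed at a later occurrence. *)
Lemma undup_flatten_map_undup {T U : eqType} (r : T -> seq U) (s : seq T) :
  undup (flatten (map r (undup s))) = undup (flatten (map r s)).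
Proof.
have mem_undupE t : flatten (map r (undup t)) =i flatten (map r t).
  by move=> b; apply/flatten_mapP/flatten_mapP => -[a];
     rewrite ?mem_undup => at_; exists a; rewrite ?mem_undup.
elim: s => //= a s IHs; case: ifP => [as_ | _] /=; rewrite !undup_cat IHs.
  rewrite (@eq_in_filter _ _ pred0) ?filter_pred0 // => b.
  rewrite mem_undup => b_ra; apply/negbF/flatten_mapP; by exists a.
by congr (_ ++ _); apply: eq_filter => b; rewrite mem_undupE.
Qed.

(** * The identities satisfied by the stalactic monoid *)

Lemma pi_stalP (u v : word letter) :
  \pi_stal%qT u = \pi_stal%qT v <-> undup u = undup v /\ perm_eq u v.
Proof.
have -> : \pi_stal%qT u = \pi_stal%qT v <-> P_stal u = P_stal v.
  by split=> [/eqmodP/eqP | eq_uv]; last by apply/eqmodP/eqP.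
rewrite P_stalP; split=> -[-> eq_uv]; split=> //.
  by apply/allP=> a _; apply/eqP.
by move=> a; move/permP: eq_uv.
Qed.

Definition substitution {X : Type} (r : X -> word letter) (w : word X) : stal :=
  \pi_stal%qT (flatten (map r w) : word letter).

Lemma substitution_morphism {X : Type} (r : X -> word letter) :
  monoid_morphism (substitution r).
Proof.
split=> // u v; rewrite /substitution -[RHS]pi_stal_mul.
by rewrite map_cat flatten_cat.
Qed.

(** Lifting the image of each variable to a word of generators shows that
    substitutions of words are all the morphisms to consider. *)
Lemma morphism_substitution {X : Type} (phi : word X -> stal) :
  monoid_morphism phi -> phi =1 substitution (fun a => repr (phi [:: a])).
Proof.
case=> phi1 phiM; elim=> [|a w IHw]; first exact: phi1.
rewrite -[a :: w]/(([:: a] : word X) * w)%g phiM IHw.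
rewrite (substitution_morphism _).2; congr (_ * _)%g.
by rewrite /substitution /= cats0 reprK.
Qed.

(** An identity holds in [stal] under all substitutions as soon as it does under
    one that maps its variables to distinct generators. *)
Lemma satisfies_stalP {X : eqType} (u v : word X) :
  satisfies stal u v <-> undup u = undup v /\ perm_eq u v.
Proof.
split=> [sat_uv | [eq_undup eq_perm] phi phi_mor]; last first.
  rewrite !(morphism_substitution _ phi_mor); apply/pi_stalP; split.
    by rewrite -undup_flatten_map_undup eq_undup undup_flatten_map_undup.
  exact/perm_flatten/perm_map.
(* The successor is there because letters are positive. *)
pose g (a : X) : letter := exist (fun n => 0 < n) (index a (u ++ v)).+1 isT.
have g_inj : {in u ++ v &, injective g}.
  by move=> a b a_uv b_uv [] /(index_inj a); apply.
have := sat_uv _ (substitution_morphism (fun a => [:: g a])).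
have flattenE w : flatten (map (fun a => [:: g a]) w) = map g w.
  by elim: w => //= a w ->.
rewrite /substitution !flattenE => /pi_stalP[eq_undup eq_perm].
split; last exact: perm_map_inj_in g_inj eq_perm.
have [g_inj_u g_inj_v] : {in u &, injective g} /\ {in v &, injective g}.
  by split=> a b a_w b_w; apply: g_inj; rewrite mem_cat ?a_w ?b_w ?orbT.
move: eq_undup; rewrite !undup_map_inj_in //.
by apply: (inj_in_map g_inj); apply/allP => a;
   rewrite mem_undup mem_cat => ->; rewrite ?orbT.
Qed.

(** * Short identities *)

Lemma perm_small_swap {T : eqType} (s t : seq T) :
  perm_eq s t -> s != t -> size s <= 2 ->
  exists p q, [/\ p != q, s = [:: p; q] & t = [:: q; p]].
Proof.
move=> eq_st; have := perm_size eq_st.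
case: s eq_st => [|a [|b [|? ?]]] // eq_st; case: t eq_st => [|c [|d [|? ?]]] //.
  move=> /perm_mem /(_ c); rewrite mem_head inE => /eqP-> _.
  by rewrite eqxx.
move=> eq_st _ neq_st _; exists a, b.
case: (eqVneq c a) eq_st neq_st => [-> | c_neq_a] eq_st neq_st.
  move: eq_st; rewrite perm_cons => /perm_mem /(_ d).
  by rewrite mem_head inE => /eqP eq_db; rewrite eq_db eqxx in neq_st.
have := perm_mem eq_st c; rewrite mem_head !inE (negPf c_neq_a) /= => /eqP cb.
subst c; move: eq_st; rewrite -(perm_rot 1) /= /rot /= perm_cons.
move=> /perm_mem /(_ d); rewrite mem_head inE => /eqP->.
by rewrite eq_sym.
Qed.

(** Both words end with the last letter [c] of their common [undup]; what
    precedes is [pq] and [qp], and [c] is [p] or [q] because [pqc] and [qpc] have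
    different last occurrence orders otherwise. *)
Lemma short_undup_perm {T : eqType} (s t : seq T) :
  undup s = undup t -> perm_eq s t -> s != t -> size s <= 3 ->
  exists a b, a != b /\
    (s = [:: a; b; a] /\ t = [:: b; a; a] \/
     s = [:: b; a; a] /\ t = [:: a; b; a]).
Proof.
case/lastP: s => [|s c] eq_undup eq_perm neq_st.
  by move/perm_size/esym/size0nil: eq_perm neq_st => ->.
case/lastP: t => [|t d] in eq_undup eq_perm neq_st *.
  by move/perm_size: eq_perm; rewrite size_rcons.
have /rcons_inj[_ eq_cd] : rcons [seq y <- undup s | y != c] c
    = rcons [seq y <- undup t | y != d] d by rewrite -!undup_rcons.
subst d; rewrite size_rcons ltnS => short.
have neq : s != t by apply: contraNneq neq_st => ->.
have perm_st : perm_eq s t by move: eq_perm; rewrite -!cats1 perm_cat2r.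
have [p [q [pq s_pq t_qp]]] := perm_small_swap _ _ perm_st neq short.
subst s t; have [cp | cp] := eqVneq c p.
  by subst c; exists p, q; split=> //; left.
have [cq | cq] := eqVneq c q.
  by subst c; exists q, p; split; [rewrite eq_sym | right].
move: eq_undup; rewrite /= !inE (negPf pq) [q == p]eq_sym (negPf pq).
rewrite [p == c]eq_sym (negPf cp) [q == c]eq_sym (negPf cq).
by case=> /eqP; rewrite (negPf pq).
Qed.

Lemma short_stal_identity {X : choiceType} (u v : word X) :
  u <> v -> satisfies stal u v -> size u + size v <= 6 ->
  exists a b, a != b /\
    (u = [:: a; b; a] /\ v = [:: b; a; a] \/
     u = [:: b; a; a] /\ v = [:: a; b; a]).
Proof.
move=> /eqP neq_uv /satisfies_stalP[eq_undup eq_perm] short.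
apply: short_undup_perm => //.
by move: short; rewrite -(perm_size eq_perm) addnn -[6]/(3.*2) leq_double.
Qed.

Theorem proposition3p7 (V : Type) (x y : V) (x_neq_y : x <> y) :
  let xyx : word V := [:: x; y; x] in
  let yxx : word V := [:: y; x; x] in
  [/\ xyx <> yxx,
      satisfies stal xyx yxx,
      shortest_identity stal xyx yxx
    & forall (X : Type) (u v : word X),
        shortest_identity stal u v -> equivalent_identities u v xyx yxx].
Proof.
move=> xyx yxx.
have neq : xyx <> yxx by case.
have sat : satisfies stal xyx yxx.
  apply/(@satisfies_stalP {classic V}); split.
    rewrite /= !inE !eqxx orbT.
    by have /eqP/negPf-> : (y : {classic V}) <> x by move/esym.
  by rewrite -[yxx]/(rot 1 [:: x; y; x]) perm_sym perm_rot.
split=> //; first split=> //.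
  move=> Y u' v' neq' sat'; rewrite leqNgt; apply/negP => short.
  have [a [b [_ [] [eq_u eq_v]]]] :=
    short_stal_identity (X := {classic Y}) u' v' neq' sat' (ltnW short);
  by rewrite eq_u eq_v in short.
move=> X u v [neq_uv sat_uv min_uv].
have [a [b [ab eq_uv]]] :=
  short_stal_identity (X := {classic X}) u v neq_uv sat_uv (min_uv _ _ _ neq sat).
pose f (c : {classic X}) := if c == a then x else y.
have fa : f a = x by rewrite /f eqxx.
have fb : f b = y by rewrite /f eq_sym (negPf ab).
have f_inj : {in [:: a; b] &, injective f}.
  by move=> c d; rewrite !inE => /orP[] /eqP-> /orP[] /eqP->;
     rewrite ?fa ?fb // => /esym.
have f_renames w : {subset w <= [:: a; b]} -> forall c d : X,
    List.In c w -> List.In d w -> f c = f d -> c = d.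
  move=> sub c d /(@mem_In {classic X}) /sub c_ab.
  by move=> /(@mem_In {classic X}) /sub d_ab; apply: f_inj.
by case: eq_uv => -[-> ->]; [left | right]; exists f;
   split; rewrite /= ?fa ?fb //; apply: (f_renames [:: _; _; _; _; _; _]);
   apply/allP; rewrite /= !inE !eqxx ?orbT.
Qed.
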